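(* Suppose $a$ and $\overline{a}$ are positive braids that are conjugate in $B_3$. Then $a$ and $\overline{a}$ are cyclic equivalent if and only if at least one of the following conditions fails: (1) $\inf(a)=0$; (2) $a$ is either of the first form, or of the second form with $a_1,a_k\ge 2$ (first and second form as defined in the context); (3) $a\neq (c\,\overline{c})^{\ell}$ for every positive word $c$ and every $\ell\in\mathbb{N}$.
   Context: $B_3$ is the braid group on $3$ strands, with generators $\sigma_1,\sigma_2$ and the single defining relation $\sigma_1\sigma_2\sigma_1=\sigma_2\sigma_1\sigma_2$. $B_3^+$ is the positive braid monoid, with the same generators and relation; it embeds in $B_3$ and is identified with the submonoid of $B_3$ generated by $\sigma_1,\sigma_2$; its elements are the positive braids. A positive word is a finite (possibly empty) word in the letters $\sigma_1,\sigma_2$. $\mathbb{N}=\{1,2,3,\dots\}$. Garside element: $\Delta_3=\sigma_1\sigma_2\sigma_1$. Cyclic equivalence: $a,b\in B_3^+$ are cyclic equivalent if there is a finite sequence $a=a_0,a_1,\dots,a_m=b$ in $B_3^+$ such that for each $i=0,\dots,m-1$ there are positive words $w_1,w_2$ (depending on $i$) with $w_1w_2$ representing $a_i$ and $w_2w_1$ representing $a_{i+1}$. Infimum: every $a\in B_3$ can be written uniquely as $a=\Delta_3^mP$ with $m\in\mathbb{Z}$ and $P\in B_3^+$ not containing $\Delta_3$ as a factor (i.e. $P$ is not of the form $u\Delta_3 v$ with $u,v\in B_3^+$); then $\inf(a):=m$. Reflection: $\overline{a}:=\Delta_3^{-1}a\Delta_3=\Delta_3a\Delta_3^{-1}$;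 it is the automorphism exchanging $\sigma_1$ and $\sigma_2$. For a positive word $c$, $\overline{c}$ is the word obtained by exchanging the letters $\sigma_1$ and $\sigma_2$. Forms: the positive $3$-braids with infimum zero are exactly those of the following two forms, where $\{i,j\}=\{1,2\}$, $k\ge 0$, $a_1,a_k\ge 1$, and $a_r\ge 2$ for $2\le r\le k-1$. First form: $\sigma_i^{a_1}\sigma_j^{a_2}\sigma_i^{a_3}\sigma_j^{a_4}\cdots\sigma_i^{a_k}$ (alternating, $k$ odd, beginning and ending with powers of the same generator; the empty case $k=0$, i.e. the trivial braid, is counted here). Second form: $\sigma_i^{a_1}\sigma_j^{a_2}\sigma_i^{a_3}\sigma_j^{a_4}\cdots\sigma_i^{a_{k-1}}\sigma_j^{a_k}$ (alternating, $k\geq 2$ even, beginning and ending with powers of different generators). *)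

(* Defs.v *)
From HB Require Import structures.
From mathcomp Require Import all_boot ssralg ssrint.
From mathcomp Require Import boolp.

Set Implicit Arguments.
Unset Strict Implicit.
Unset Printing Implicit Defensive.

Local Open Scope quotient_scope.
Local Open Scope group_scope.

(* The generators sigma_1 and sigma_2 are indexed by [false] and [true], so
   that boolean negation exchanges them. *)
Definition letter := bool.

(* In a signed letter [(i, e)], the boolean [e] marks an inverse. *)
Definition sletter : Type := (letter * bool)%type.

Definition sinv (x : sletter) : sletter := (x.1, ~~ x.2).

Inductive braid_eq : seq sletter -> seq sletter -> Prop :=
| braid_eq_refl w : braid_eq w w
| braid_eq_sym w w' : braid_eq w w' -> braid_eq w' w
| braid_eq_trans w1 w2 w3 :
    braid_eq w1 w2 -> braid_eq w2 w3 -> braid_eq w1 w3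
| braid_eq_cat u u' v v' :
    braid_eq u u' -> braid_eq v v' -> braid_eq (u ++ v) (u' ++ v')
| braid_eq_cancel x : braid_eq [:: x; sinv x] [::]
| braid_eq_braid :
    braid_eq [:: (false, false); (true, false); (false, false)]
             [:: (true, false); (false, false); (true, false)].

Definition braid_eqb (w w' : seq sletter) : bool := `[< braid_eq w w' >].

Lemma braid_eqb_refl : reflexive braid_eqb.
Proof. by move=> w; apply/asboolP; apply: braid_eq_refl. Qed.

Lemma braid_eqb_sym : symmetric braid_eqb.
Proof.
by move=> w w'; apply/asboolP/asboolP; apply: braid_eq_sym.
Qed.

Lemma braid_eqb_trans : transitive braid_eqb.
Proof.
move=> w2 w1 w3 /asboolP h12 /asboolP h23; apply/asboolP.
exact: braid_eq_trans h12 h23.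
Qed.

Canonical braid_equiv :=
  EquivRel braid_eqb braid_eqb_refl braid_eqb_sym braid_eqb_trans.

Definition B3 := {eq_quot braid_equiv}.
HB.instance Definition _ := Choice.on B3.

Definition winv (w : seq sletter) : seq sletter := rev (map sinv w).

Definition B3_one : B3 := \pi_B3 [::].
Definition B3_mul (x y : B3) : B3 := \pi_B3 (repr x ++ repr y).
Definition B3_inv (x : B3) : B3 := \pi_B3 (winv (repr x)).

Lemma B3P w w' : braid_eq w w' <-> \pi_B3 w = \pi_B3 w'.
Proof.
split=> [h|/eqquotP/asboolP//].
by apply/eqquotP/asboolP.
Qed.

Lemma B3_repr w : braid_eq (repr (\pi_B3 w)) w.
Proof. by apply/B3P; rewrite reprK. Qed.

Lemma sinvK : involutive sinv.
Proof. by case=> i e; rewrite /sinv /= negbK. Qed.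

Lemma winv_cat u v : winv (u ++ v) = winv v ++ winv u.
Proof. by rewrite /winv map_cat rev_cat. Qed.

Lemma winvK : involutive winv.
Proof. by move=> w; rewrite /winv map_rev revK mapK //; exact: sinvK. Qed.

Lemma braid_eq_winvr w : braid_eq (w ++ winv w) [::].
Proof.
elim: w => [|x w IH]; first exact: braid_eq_refl.
rewrite -cat1s winv_cat -!catA (catA w).
apply: (braid_eq_trans _ (braid_eq_cancel x)).
apply: (@braid_eq_cat [:: x] [:: x]); first exact: braid_eq_refl.
exact: (braid_eq_cat IH (braid_eq_refl _)).
Qed.

Lemma B3_mulE u v : B3_mul (\pi_B3 u) (\pi_B3 v) = \pi_B3 (u ++ v).
Proof. by apply/B3P; apply: braid_eq_cat; apply: B3_repr. Qed.

Lemma B3_mulA : associative B3_mul.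
Proof.
elim/quotW=> u; elim/quotW=> v; elim/quotW=> w.
by rewrite (B3_mulE v w) (B3_mulE u v) !B3_mulE catA.
Qed.

Lemma B3_mul1 : left_id B3_one B3_mul.
Proof. by elim/quotW=> u; rewrite B3_mulE. Qed.

Lemma B3_mulr1 : right_id B3_one B3_mul.
Proof. by elim/quotW=> u; rewrite B3_mulE cats0. Qed.

Lemma B3_mulV : left_inverse B3_one B3_inv B3_mul.
Proof.
move=> x; rewrite -{2}(reprK x) B3_mulE; apply/B3P.
by have := braid_eq_winvr (winv (repr x)); rewrite winvK.
Qed.

Lemma B3_mulrV : right_inverse B3_one B3_inv B3_mul.
Proof.
move=> x; rewrite -{1}(reprK x) B3_mulE; apply/B3P.
exact: braid_eq_winvr.
Qed.

HB.instance Definition _ :=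
  isGroup.Build B3 B3_mulA B3_mul1 B3_mulr1 B3_mulV B3_mulrV.

Definition sigma (i : letter) : B3 := \pi_B3 [:: (i, false)].

Definition braid_of (w : seq letter) : B3 := \prod_(i <- w) sigma i.

(* B_3^+, identified with the submonoid of B_3 generated by sigma_1, sigma_2. *)
Definition positive (a : B3) : Prop := exists w : seq letter, a = braid_of w.

Definition Delta : B3 := sigma false * sigma true * sigma false.

Definition reflection (a : B3) : B3 := a ^ Delta.

Definition wreflection (c : seq letter) : seq letter := map negb c.

Definition conjugate (a b : B3) : Prop := exists g : B3, b = a ^ g.

Definition cyclic_step (a b : B3) : Prop :=
  exists w1 w2 : seq letter,
    a = braid_of (w1 ++ w2) /\ b = braid_of (w2 ++ w1).

Definition cyclic_equivalent (a b : B3) : Prop :=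
  exists (m : nat) (s : nat -> B3),
    [/\ s 0%N = a, s m = b,
        forall i, (i <= m)%N -> positive (s i) &
        forall i, (i < m)%N -> cyclic_step (s i) (s i.+1)].

Definition expgz (x : B3) (m : int) : B3 :=
  match m with Posz n => x ^+ n | Negz n => x ^- n.+1 end.

Definition has_Delta_factor (P : B3) : Prop :=
  exists u v : B3, [/\ positive u, positive v & P = u * Delta * v].

Definition is_inf (a : B3) (m : int) : Prop :=
  exists P : B3,
    [/\ positive P, ~ has_Delta_factor P & a = expgz Delta m * P].

Lemma pi_mul u v : (\pi_B3 u : B3) * (\pi_B3 v : B3) = \pi_B3 (u ++ v).
Proof. exact: B3_mulE. Qed.

Lemma sigma_cancel i : sigma i * (\pi_B3 [:: (i, true)] : B3) = 1.
Proof.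
by rewrite /sigma pi_mul; apply/B3P; apply: braid_eq_cancel.
Qed.

Lemma sigma_inv i : \pi_B3 [:: (i, true)] = (sigma i)^-1.
Proof. by apply: (mulgI (sigma i)); rewrite sigma_cancel mulgV. Qed.

Lemma DeltaE i : Delta = sigma i * sigma (~~ i) * sigma i.
Proof.
case: i => //=; rewrite /Delta /sigma !pi_mul.
by apply/B3P; apply: braid_eq_braid.
Qed.

Lemma sigma_Delta i : sigma i * Delta = Delta * sigma (~~ i).
Proof. by rewrite {1}(DeltaE (~~ i)) (DeltaE i) negbK !mulgA. Qed.

Lemma braid_of_cons i w : braid_of (i :: w) = sigma i * braid_of w.
Proof. by rewrite /braid_of big_cons. Qed.

Lemma braid_of_cat u v : braid_of (u ++ v) = braid_of u * braid_of v.
Proof. by rewrite /braid_of big_cat. Qed.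

Lemma braid_of_Delta w : braid_of w * Delta = Delta * braid_of (wreflection w).
Proof.
elim: w => [|i w IH]; first by rewrite /braid_of !big_nil mulg1 mul1g.
by rewrite /= !braid_of_cons -mulgA IH mulgA sigma_Delta mulgA.
Qed.

Definition exponent_sum (w : seq sletter) : int :=
  foldr (fun x n => (if x.2 then -1 else 1) + n)%R 0%R w.

Lemma exponent_sum_cat u v :
  exponent_sum (u ++ v) = (exponent_sum u + exponent_sum v)%R.
Proof.
by elim: u => [|x u IH] /=; rewrite ?GRing.add0r // IH GRing.addrA.
Qed.

Lemma exponent_sum_eq w w' :
  braid_eq w w' -> exponent_sum w = exponent_sum w'.
Proof.
elim=> //= [? ? ? _ -> _ -> //|? ? ? ? _ IHu _ IHv|[i []] //].
by rewrite !exponent_sum_cat IHu IHv.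
Qed.

Lemma braid_ofE w : braid_of w = \pi_B3 [seq (i, false) | i <- w].
Proof.
elim: w => [|i w IH]; first by rewrite /braid_of big_nil.
by rewrite braid_of_cons IH /sigma pi_mul.
Qed.

Lemma braid_of_size w w' : braid_of w = braid_of w' -> size w = size w'.
Proof.
rewrite !braid_ofE => /B3P/exponent_sum_eq.
have H (v : seq letter) : exponent_sum [seq (i, false) | i <- v] = size v.
  by elim: v => //= i v ->; rewrite -PoszD.
by rewrite !H => -[].
Qed.

Lemma expgzS x m : expgz x (1 + m)%R = x * expgz x m.
Proof.
case: m => [n|[|n]]; [by rewrite /= -expgS|by rewrite /= mulgV|].
have -> : (1 + Negz n.+1)%R = Negz n.
  by rewrite !NegzE -[n.+2]add1n PoszD GRing.opprD GRing.addNKr.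
by rewrite /= [x ^+ n.+2]expgSr invgM mulgA mulgV mul1g.
Qed.

Lemma expgzC x m : expgz x m * x = x * expgz x m.
Proof.
case: m => n /=; first by rewrite -expgS expgSr.
by apply: commute_sym; apply: commuteV; apply: commuteX.
Qed.

Lemma expgzDn x n m : expgz x (Posz n + m)%R = x ^+ n * expgz x m.
Proof.
elim: n => [|n IH]; first by rewrite GRing.add0r mul1g.
by rewrite -add1n PoszD -GRing.addrA expgzS IH mulgA add1n expgS.
Qed.

Lemma sigma_expgz i m :
  sigma i * expgz Delta m = expgz Delta m * sigma (i (+) odd `|m|%N).
Proof.
have H n k : sigma k * Delta ^+ n = Delta ^+ n * sigma (k (+) odd n).
  elim: n k => [|n IH] k; first by rewrite mulg1 mul1g addbF.
  by rewrite expgS mulgA sigma_Delta -!mulgA IH /= addbN addNb.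
case: m => n /=; first exact: H.
apply: (mulgI (Delta ^+ n.+1)); rewrite !mulgA mulgV mul1g.
have := H n.+1 (i (+) odd n.+1); rewrite -addbA addbb addbF => <-.
by rewrite mulgK.
Qed.

Lemma DeltaV_braid a : exists m w, a = expgz Delta m * braid_of w.
Proof.
elim/quotW: a; elim=> [|[i e] u [m [w IH]]].
  by exists 0%R, [::]; rewrite /braid_of big_nil mulg1.
have -> : \pi_B3 ((i, e) :: u) = (\pi_B3 [:: (i, e)] : B3) * (\pi_B3 u : B3).
  by rewrite pi_mul.
rewrite IH mulgA; case: e; last first.
  exists m, ((i (+) odd `|m|%N) :: w).
  by rewrite -/(sigma i) sigma_expgz braid_of_cons mulgA.
have Dm : Delta * expgz Delta (m - 1)%R = expgz Delta m.
  by rewrite -expgzS GRing.addrC GRing.subrK.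
pose f k := k (+) odd `|(m - 1)%R|%N.
exists (m - 1)%R, (f (~~ i) :: f i :: w).
rewrite !braid_of_cons !mulgA /=; congr (_ * _).
rewrite sigma_inv -Dm /f -(sigma_expgz (~~ i) (m - 1)%R).
rewrite -[RHS]mulgA -(sigma_expgz i (m - 1)%R) (DeltaE i) !mulgA.
by rewrite mulVg mul1g.
Qed.

Lemma inf_exists a : exists m, is_inf a m.
Proof.
have [m [w ->]] := DeltaV_braid a.
have [n] := ubnP (size w); elim: n m w => // n IH m w ltwn.
have [|noD] := pselect (has_Delta_factor (braid_of w)).
  move=> [u [v [[wu ->] [wv ->] E]]].
  have E' : braid_of w = Delta * braid_of (wreflection wu ++ wv).
    by rewrite E braid_of_Delta braid_of_cat mulgA.
  have szw : size w = (size (wreflection wu ++ wv) + 3)%N.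
    move: E'; have -> : Delta = braid_of [:: false; true; false].
      by rewrite /braid_of !big_cons big_nil mulg1 /Delta mulgA.
    by rewrite -braid_of_cat => /braid_of_size ->; rewrite size_cat addnC.
  have [|p Hp] := IH (1 + m)%R (wreflection wu ++ wv).
    move: ltwn; rewrite szw addn3 ltnS; apply: leq_trans.
    by rewrite !ltnS ltnW.
  by exists p; rewrite E' mulgA expgzC -expgzS.
by exists m, (braid_of w); split=> //; exists w.
Qed.

Lemma is_inf_unique a m n : is_inf a m -> is_inf a n -> m = n.
Proof.
have DX k : positive (Delta ^+ k).
  elim: k => [|k [w IH]]; first by exists [::]; rewrite /braid_of big_nil.
  exists ([:: false; true; false] ++ w).
  by rewrite !braid_of_cons expgS -IH /Delta !mulgA.
have H k p : is_inf a (Posz k.+1 + p)%R -> is_inf a p -> False.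
  move=> [P [posP _ ->]] [Q [_ noD E]]; case: noD.
  exists (Delta ^+ k), P; split=> //; apply: (mulgI (expgz Delta p)).
  rewrite -E expgzDn -expgSr mulgA; congr (_ * _).
  exact/commute_sym/commuteX/expgzC.
move=> infm infn; case E: (m - n)%R => [[|k]|k].
- by apply/eqP; rewrite -GRing.subr_eq0 E.
- by case: (@H k n) => //; rewrite -E GRing.subrK.
- case: (@H k m) => //.
  by rewrite -[Posz k.+1]GRing.opprK -NegzE -E GRing.opprB GRing.subrK.
Qed.

Definition braid_inf (a : B3) : int := sval (cid (inf_exists a)).

(* The product sigma_i^a_1 sigma_j^a_2 sigma_i^a_3 ... for s = [a_1; ...; a_k],
   where {i, j} = {1, 2}. *)
Fixpoint alternating (i : letter) (s : seq nat) : B3 :=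
  if s is n :: s' then sigma i ^+ n * alternating (~~ i) s' else 1.

(* a_1, a_k >= 1 and a_r >= 2 for 2 <= r <= k - 1; the entry a_r is
   [nth 0 s r.-1]. *)
Definition admissible (s : seq nat) : Prop :=
  [/\ s != [::] -> (1 <= head 0 s)%N,
      s != [::] -> (1 <= last 0 s)%N &
      forall r, (2 <= r <= (size s).-1)%N -> (2 <= nth 0 s r.-1)%N].

Definition first_form (i : letter) (s : seq nat) (a : B3) : Prop :=
  [/\ s = [::] \/ odd (size s), admissible s & a = alternating i s].

Definition second_form (i : letter) (s : seq nat) (a : B3) : Prop :=
  [/\ (2 <= size s)%N, ~~ odd (size s), admissible s & a = alternating i s].

(* Main.v *)
(** The group [B_3] acts on normal forms [w Delta^m], where the word [w] has no
    factor [iji]; hence such a "reduced" word is the only positive word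
    representing its braid.  The condition on the form of [a] says that [a] is
    represented by a word [w] with [w ++ w] reduced: then every rotation of [w]
    is reduced, the cyclic class of [a] consists of the rotations of [w], and
    if one of them is the reflected word, then Euclid's algorithm applied to
    the rotation length and to [size w] writes [w] as a power of [c cbar].
    Otherwise some rotation of [a] is [Delta u], and [Delta u] is cyclically
    equivalent to [u Delta], which is its reflection. *)
Require Import Defs.
From mathcomp Require Import all_boot ssralg ssrint.
From mathcomp Require Import boolp zify.

Local Open Scope group_scope.

(** * Words without a factor [iji] *)

Fixpoint reduced (w : seq letter) : bool :=
  if w is i :: w' then (take 2 w' != [:: ~~ i; i]) && reduced w' else true.

Lemma reduced_cons i w :
  reduced (i :: w) = (take 2 w != [:: ~~ i; i]) && reduced w.
Proof. by []. Qed.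

Lemma reduced_catr u v : reduced (u ++ v) -> reduced v.
Proof. by elim: u => //= i u IH /andP[_ /IH]. Qed.

Lemma reduced_catl u v : reduced (u ++ v) -> reduced u.
Proof.
elim: u => //= i u IH /andP[+ /IH ->]; rewrite andbT.
case: u {IH} => [|j [|k u]] //=; last by rewrite !take0.
by case: i; case: j; rewrite /= ?eqseq_cons ?andbF.
Qed.

Lemma reduced_negb w : reduced (map negb w) = reduced w.
Proof.
elim: w => //= i w ->; congr (_ && _).
rewrite -map_take -[[:: ~~ ~~ i; _]]/(map negb [:: ~~ i; i]).
by rewrite (inj_eq (inj_map negb_inj)).
Qed.

Lemma reducedPn w :
  ~~ reduced w -> exists p i q, w = p ++ [:: i; ~~ i; i] ++ q.
Proof.
elim: w => //= i w IH; rewrite negb_and negbK => /orP[/eqP E|/IH].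
  by exists [::], i, (drop 2 w); rewrite -[w in LHS](cat_take_drop 2) E.
by move=> [p [k [q ->]]]; exists (i :: p), k, q.
Qed.

(** * The action of B_3 on normal forms, and uniqueness of reduced words *)

(* The pair [(m, w)] stands for the braid [w Delta^m]. *)
Definition state : Type := (int * seq letter)%type.

(** Left multiplication by Delta: moving Delta to the right past w exchanges the two letters. *)
Definition dact (x : state) : state := ((x.1 + 1)%R, map negb x.2).

Definition dactV (x : state) : state := ((x.1 - 1)%R, map negb x.2).

(** A letter put before a reduced word can create [iji] only at the front; that factor is a Delta,
    which is pushed to the right. *)
Definition sact (i : letter) (x : state) : state :=
  if take 2 x.2 == [:: ~~ i; i] then dact (x.1, drop 2 x.2)
  else (x.1, i :: x.2).

(** Since Delta = sigma_i sigma_j sigma_i, the inverse of sigma_i is sigma_j sigma_i Delta^-1. *)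
Definition sactV (i : letter) (x : state) : state :=
  sact (~~ i) (sact i (dactV x)).

Definition act (w : seq sletter) (x : state) : state :=
  foldr (fun l => if l.2 then sactV l.1 else sact l.1) x w.

Lemma dactVK x : dact (dactV x) = x.
Proof. by case: x => m w; rewrite /dactV /dact /= GRing.subrK (mapK negbK). Qed.

Lemma sact_reduced i x : reduced x.2 -> reduced (sact i x).2.
Proof.
move=> rx; rewrite /sact; case: ifP => /= [_|->//].
by rewrite reduced_negb (@reduced_catr (take 2 x.2)) // cat_take_drop.
Qed.

Lemma dactV_reduced x : reduced (dactV x).2 = reduced x.2.
Proof. exact: reduced_negb. Qed.

Lemma sactV_reduced i x : reduced x.2 -> reduced (sactV i x).2.
Proof. by move=> rx; do 2!apply: sact_reduced; rewrite dactV_reduced. Qed.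

Lemma act_reduced w x : reduced x.2 -> reduced (act w x).2.
Proof.
move=> rx; elim: w => //= -[i []] w IH /=; first exact: sactV_reduced.
exact: sact_reduced.
Qed.

Lemma sact_dactV i x : sact i (dactV x) = dactV (sact (~~ i) x).
Proof.
case: x => m w; rewrite /sact /dactV /dact /= -map_take.
rewrite -[[:: ~~ i; i]](mapK negbK) (inj_eq (inj_map negb_inj)) /=.
case: ifP => _ /=; last by rewrite negbK.
by congr (_, _); [lia|rewrite -map_drop].
Qed.

Lemma sact_braid i x :
  reduced x.2 -> sact i (sact (~~ i) (sact i x)) = dact x.
Proof.
case: x => m w /=.
(* As w has no factor [iji], its first four letters at most decide the outcome. *)
case: i; case: w => [|[] [|[] [|[] [|[] w]]]] //= rw;
  by rewrite /sact /dact /= ?take0 ?drop0 /= ?drop0 ?(mapK negbK) ?take0 //=.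
Qed.

Lemma sactVK i x : reduced x.2 -> sact i (sactV i x) = x.
Proof. by move=> rx; rewrite sact_braid ?dactVK ?dactV_reduced. Qed.

Lemma sactK i x : reduced x.2 -> sactV i (sact i x) = x.
Proof.
move=> rx; have := sact_dactV (~~ i) x; rewrite negbK /sactV => <-.
by have := sact_braid (~~ i) (dactV x); rewrite negbK => ->;
  rewrite ?dactVK ?dactV_reduced.
Qed.

(** Each relation of B_3 holds between the actions on reduced states, and these states are
    preserved, so [act] depends only on the braid. *)
Lemma act_braid_eq w w' :
  braid_eq w w' -> forall x, reduced x.2 -> act w x = act w' x.
Proof.
elim=> {w w'} //.
- by move=> w w' _ IH x rx; rewrite IH.
- by move=> w1 w2 w3 _ IH1 _ IH2 x rx; rewrite IH1 ?IH2.
- move=> u u' v v' _ IHu _ IHv x rx; rewrite /act !foldr_cat -!/(act _ _).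
  by rewrite IHv // IHu // act_reduced.
- by move=> [i []] x rx; [apply: sactK|apply: sactVK].
- move=> x rx /=; rewrite (@sact_braid false) //.
  by rewrite -(@sact_braid true).
Qed.

Definition pact (w : seq letter) : state :=
  foldr sact (0%R, [::]) w.

Lemma pact_act w : pact w = act [seq (i, false) | i <- w] (0%R, [::]).
Proof. by elim: w => //= i w ->. Qed.

(** The exponent of Delta never decreases, and it stays 0 only if no letters were ever absorbed into
    a Delta. *)
Lemma pact_stable w :
  exists n : nat, (pact w).1 = Posz n /\ (n = 0%N -> (pact w).2 = w).
Proof.
elim: w => [|i w [n [IH1 IH2]]] /=; first by exists 0%N.
rewrite /sact; case: ifP => _ /=; last by exists n; split=> // /IH2 ->.
by exists n.+1; split=> //; rewrite IH1; lia.
Qed.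

Lemma pact_id w : reduced w -> pact w = (0%R, w).
Proof.
elim: w => //= i w IH /andP[/negbTE niji /IH ->].
by rewrite /sact /= niji.
Qed.

Lemma reduced_unique w w' : reduced w -> braid_of w = braid_of w' -> w' = w.
Proof.
rewrite !braid_ofE => rw /B3P/act_braid_eq/(_ (0%R, [::]) isT).
rewrite -!pact_act (pact_id _ rw) => E.
(* Both words reach the same state; its exponent is 0, so w' was left unchanged too. *)
by have [n []] := pact_stable w'; rewrite -E => -[<-] /(_ erefl).
Qed.

(** * Words as alternating powers, and the meaning of the form condition *)

Fixpoint altword (i : letter) (s : seq nat) : seq letter :=
  if s is n :: s' then nseq n i ++ altword (~~ i) s' else [::].

Lemma braid_of_altword i s : braid_of (altword i s) = alternating i s.
Proof.
elim: s i => [|n s IH] i /=; first by rewrite /braid_of big_nil.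
rewrite braid_of_cat IH; congr (_ * _).
elim: n => [|n IHn]; first by rewrite /braid_of big_nil.
by rewrite /= braid_of_cons IHn expgS.
Qed.

Lemma altword_cat i s t :
  altword i (s ++ t) = altword i s ++ altword (i (+) odd (size s)) t.
Proof.
elim: s i => [|n s IH] i /=; first by rewrite addbF.
by rewrite IH catA addbN addNb.
Qed.

Lemma altwordP w : exists i s, w = altword i s /\ all (leq 1) s.
Proof.
elim: w => [|i w [k [[|n s] [-> //= pos]]]]; first by exists false, [::].
  by exists i, [:: 1%N].
have [<-|/negPf nki] := eqVneq k i.
  by exists k, (n.+1 :: s); case/andP: pos.
exists i, [:: 1%N, n & s]; split=> //=.
by have -> : k = ~~ i by move: nki; case: (k) (i) => [] [].
Qed.

Lemma reduced_nseq n i w : reduced (nseq n.+1 i ++ w) = reduced (i :: w).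
Proof. by elim: n => //= n ->; case: i. Qed.

Lemma altword_cons i n s : altword i (n :: s) = nseq n i ++ altword (~~ i) s.
Proof. by []. Qed.

Lemma reduced_const n i : reduced (nseq n i).
Proof.
by case: n => // n; rewrite -[nseq _ _]cats0 reduced_nseq.
Qed.

(** A factor [iji] amounts to an interior block of length 1; the two end blocks may have any
    positive length. *)
Lemma reduced_altword i a m b : (0 < a)%N -> (0 < b)%N -> all (leq 1) m ->
  reduced (altword i (a :: rcons m b)) = all (leq 2) m.
Proof.
case: b => // b + _; elim: m i a => [|c m IH] i [//|a] _.
  move=> _; rewrite altword_cons reduced_nseq reduced_cons.
  rewrite altword_cons cats0 reduced_const andbT.
  by case: b => [|b]; case: i; rewrite /= ?take0.
case/andP=> c0 posm; rewrite altword_cons reduced_nseq reduced_cons.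
rewrite -[rcons _ _]/(c :: rcons m b.+1) IH //; congr (_ && _).
case: c c0 => [//|[|c]] _; last by case: i.
by case: m posm {IH} => [|[|d] m] //= _; rewrite negbK ?take0 eqxx.
Qed.

Lemma seq_ends (s : seq nat) :
  [\/ s = [::], exists a, s = [:: a] | exists a m b, s = a :: rcons m b].
Proof.
case: s => [|a s]; first by constructor 1.
case/lastP: s => [|m b]; first by constructor 2; exists a.
by constructor 3; exists a, m, b.
Qed.

Lemma admissible_ends a m b :
  admissible (a :: rcons m b) <-> [/\ (0 < a)%N, (0 < b)%N & all (leq 2) m].
Proof.
rewrite /admissible /= last_rcons size_rcons.
split=> [[/(_ isT) a0 /(_ isT) b0 H]|].
  split=> //; apply/(all_nthP 0%N) => r rm.
  by have := H r.+2 rm; rewrite /= nth_rcons rm.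
move=> [a0 b0 /(all_nthP 0%N) H]; split=> // -[|[|r]] //= rm.
by move: rm; rewrite ltnS => rm; rewrite nth_rcons rm H.
Qed.

Definition form_condition (a : B3) : Prop :=
  (exists (i : letter) (s : seq nat), first_form i s a) \/
  (exists (i : letter) (s : seq nat),
     [/\ second_form i s a, (2 <= head 0 s)%N & (2 <= last 0 s)%N]).

Lemma sub_leq12 m : all (leq 2) m -> all (leq 1) m.
Proof. by apply: sub_all => n; apply: ltnW. Qed.

(** With an odd number of blocks, the last and the first are powers of the same generator and merge
    at the junction; the merged exponent is at least 2 as soon as a and b are positive. *)
Lemma altword_sqr_odd i a m b : odd (size m) ->
  altword i (a :: rcons m b) ++ altword i (a :: rcons m b) =
  altword i (a :: rcons (m ++ (b + a)%N :: m) b).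
Proof.
move=> om; rewrite -[in RHS]cats1 -catA -cat_cons altword_cat /= om addbF.
rewrite cats1 nseqD -!catA.
rewrite -[_ ++ altword _ (rcons m b)]/(altword i (a :: rcons m b)).
by rewrite -cats1 altword_cat om !catA /= addNb addbT negbK cats0.
Qed.

(** With an even number of blocks, the end blocks meet without merging and become interior; this is
    where a_1, a_k >= 2 comes from. *)
Lemma altword_sqr_even i a m b : ~~ odd (size m) ->
  altword i (a :: rcons m b) ++ altword i (a :: rcons m b) =
  altword i (a :: rcons (m ++ [:: b, a & m]) b).
Proof.
move=> om; set s := a :: rcons m b.
have -> : a :: rcons (m ++ [:: b, a & m]) b = s ++ s.
  by rewrite /s rcons_cat /= -cats1 -catA.
by rewrite altword_cat /s /= size_rcons /= negbK (negPf om) addbF.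
Qed.

Lemma form_condition_word a :
  form_condition a -> exists w, a = braid_of w /\ reduced (w ++ w).
Proof.
case=> [[i [s [odds adm ->]]]|[i [s [[ges odds adm ->] h l]]]];
  exists (altword i s); rewrite braid_of_altword; split=> //.
- case: (seq_ends s) odds adm => [->//|[n ->]|[n [m [b ->]]]] /=.
    by rewrite cats0 cat_nseq /ncons -iterD reduced_const.
  case=> [//|]; rewrite size_rcons /= negbK => om.
  move=> /admissible_ends[n0 b0 m2].
  rewrite -[X in X ++ X]/(altword i (n :: rcons m b)).
  rewrite altword_sqr_odd // reduced_altword // ?all_cat /=
    ?m2 ?(sub_leq12 _ m2) //.
    by lia.
  by lia.
- case: (seq_ends s) ges odds adm h l => [->//|[n ->//]|[n [m [b ->]]]] _.
  rewrite /= size_rcons /= last_rcons negbK => om.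
  move=> /admissible_ends[n0 b0 m2] n2 b2.
  rewrite -[X in X ++ X]/(altword i (n :: rcons m b)).
  by rewrite altword_sqr_even // reduced_altword // ?all_cat /=
    ?m2 ?(sub_leq12 _ m2) ?n0 ?b0 ?n2 ?b2.
Qed.

Lemma word_form_condition w : reduced (w ++ w) -> form_condition (braid_of w).
Proof.
have [i [s [-> pos]]] := altwordP w.
case: (seq_ends s) pos => [->|[n ->]|[n [m [b ->]]]].
- by left; exists i, [::]; rewrite braid_of_altword; split=> //;
    [left|split=> // -[|[]]].
- rewrite /= andbT => n0 _; left; exists i, [:: n].
  split; [by right| |exact: (braid_of_altword i [:: n])].
  by split=> // -[|[]].
rewrite [all _ _]/= all_rcons => /and3P[n0 b0 posm].
have [om|om] := boolP (odd (size m)).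
  rewrite altword_sqr_odd // reduced_altword //; last first.
    by rewrite all_cat /= posm; lia.
  rewrite all_cat => /andP[m2 _]; left; exists i, (n :: rcons m b).
  split; [|exact/admissible_ends|exact: braid_of_altword].
  by right; rewrite /= size_rcons /= om.
rewrite altword_sqr_even // reduced_altword //; last first.
  by rewrite all_cat /= posm n0 b0.
rewrite all_cat => /and4P[m2 b2 n2 _]; right; exists i, (n :: rcons m b).
split; [|by []|by rewrite /= last_rcons].
split; [|by rewrite /= size_rcons /= negbK| |exact: braid_of_altword].
- by rewrite /= size_rcons.
- exact/admissible_ends.
Qed.

(** * Braids that are cyclically equivalent to their reflection *)

Lemma cyclic_refl w : cyclic_equivalent (braid_of w) (braid_of w).
Proof.
by exists 0%N, (fun=> braid_of w); split=> // i _; exists w.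
Qed.

Lemma cyclic_cons a b c :
  cyclic_step a b -> cyclic_equivalent b c -> cyclic_equivalent a c.
Proof.
move=> ab [m [s [s0 sm pos st]]].
exists m.+1, (fun i => if i is i'.+1 then s i' else a); split=> //.
- by case=> [_|i /pos//]; case: ab => w1 [w2 [-> _]]; exists (w1 ++ w2).
- by case=> [_|i /st//]; rewrite s0.
Qed.

Lemma reflection_braid_of w :
  reflection (braid_of w) = braid_of (wreflection w).
Proof. by rewrite /reflection conjgE braid_of_Delta mulKg. Qed.

Lemma braid_of_Delta_word i : braid_of [:: i; ~~ i; i] = Delta.
Proof. by rewrite (DeltaE i) /braid_of !big_cons big_nil mulg1 mulgA. Qed.

(** The chain is w1 w2, then w2 w1 = Delta u, then u Delta, which is the reflection of w2 w1, and
    finally the reflection of w1 w2. *)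
Lemma cyclic_reflection_Delta w1 w2 u :
  braid_of (w2 ++ w1) = Delta * braid_of u ->
  cyclic_equivalent (braid_of (w1 ++ w2)) (reflection (braid_of (w1 ++ w2))).
Proof.
move=> E; pose d := [:: false; true; false].
have dE : braid_of d = Delta := braid_of_Delta_word false.
apply: (@cyclic_cons _ (braid_of (w2 ++ w1))); first by exists w1, w2.
apply: (@cyclic_cons _ (braid_of (wreflection (w2 ++ w1)))).
  exists d, u.
  by rewrite -reflection_braid_of E /reflection conjgE -[_ * Delta]mulgA mulKg
    !braid_of_cat dE.
rewrite reflection_braid_of /wreflection !map_cat.
apply: cyclic_cons (cyclic_refl _).
by exists (map negb w2), (map negb w1).
Qed.

Lemma braid_of_iji p i q : exists u,
  braid_of (p ++ [:: i; ~~ i; i] ++ q) = Delta * braid_of u.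
Proof.
exists (wreflection p ++ q); rewrite !braid_of_cat.
by rewrite braid_of_Delta_word mulgA braid_of_Delta -[LHS]mulgA.
Qed.

(** Reflection turns (c cbar)^l into (cbar c)^l, which arises by moving the first c to the end. *)
Lemma cyclic_reflection_sqr c l : (0 < l)%N ->
  let a := (braid_of c * braid_of (wreflection c)) ^+ l in
  cyclic_equivalent a (reflection a).
Proof.
case: l => // l _ /=; set x := braid_of c; set y := braid_of _.
have yE : reflection y = x.
  by rewrite reflection_braid_of /wreflection (mapK negbK).
have xyX n : exists w, (x * y) ^+ n = braid_of w.
  elim: n => [|n [w IH]]; first by exists [::]; rewrite /braid_of big_nil.
  by exists ((c ++ wreflection c) ++ w); rewrite expgS IH !braid_of_cat.
have ra : reflection ((x * y) ^+ l.+1) = y * (x * y) ^+ l * x.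
  rewrite /reflection conjXg conjMg -/(reflection x) -/(reflection y) yE.
  rewrite reflection_braid_of -/y.
  elim: l => [|l IH]; first by rewrite mulg1.
  by rewrite expgSr IH [in RHS]expgSr !mulgA.
have [w wE] := xyX l; have [w' w'E] := xyX l.+1.
apply: (@cyclic_cons _ (reflection ((x * y) ^+ l.+1))); last first.
  by rewrite w'E reflection_braid_of; apply: cyclic_refl.
exists c, (wreflection c ++ w).
by rewrite ra !braid_of_cat -wE -/x -/y expgS !mulgA.
Qed.

(** * Rotations of a word: the cyclic class, and words rotated into their reflection *)

Lemma reduced_rot k w : reduced (w ++ w) -> reduced (rot k w).
Proof.
(* A rotation of w is a factor of [w ++ w]. *)
rewrite -{1 2}(cat_take_drop k w) -catA => /reduced_catr.
by rewrite catA => /reduced_catl.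
Qed.

(** Each braid met along the chain has a rotation of w as its only positive word, so the next step
    can only rotate that word. *)
Lemma cyclic_rot w b :
  reduced (w ++ w) -> cyclic_equivalent (braid_of w) b ->
  exists k, b = braid_of (rot k w).
Proof.
move=> rw [m [s [s0 <- _ st]]].
elim: m st => [|m IH] st; first by exists 0%N; rewrite rot0.
have [i im|k E] := IH; first by apply: st; apply: ltnW.
have [w1 [w2 []]] := st m (ltnSn m).
rewrite E => /(reduced_unique _ _ (reduced_rot k w rw)) E12 ->.
rewrite -rot_size_cat E12.
(* [rot_add_mod] wants amounts up to the size; beyond it, [rot k w] is w. *)
have [kw|/ltnW wk] := leqP k (size w); last first.
  by exists (size w1); rewrite (rot_oversize wk).
have w1w : (size w1 <= size w)%N.
  by rewrite -(size_rot k w) -E12 size_cat leq_addr.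
by eexists; rewrite rot_add_mod.
Qed.

Lemma antiperiod_word w k : rot k w = map negb w ->
  exists c l, (0 < l)%N /\
    braid_of w = (braid_of c * braid_of (wreflection c)) ^+ l.
Proof.
have [->|w0] := eqVneq w [::].
  by move=> _; exists [::], 1%N; rewrite /braid_of !big_nil mulg1.
(* A nonempty word differs from its reflection, so the rotation is not trivial. *)
move=> E; have [k0 kn] : (0 < k)%N /\ (k < size w)%N.
  have nfix : w <> map negb w by case: w w0 {E} => // -[] w _ [].
  split; [rewrite lt0n|rewrite ltnNge]; apply/negP.
    by move/eqP=> k0; apply: nfix; rewrite -E k0 rot0.
  by move=> wk; apply: nfix; rewrite -E rot_oversize.
(* f reads w cyclically: n is a period, and k will be an antiperiod. *)
set n := size w in kn; pose f x := nth false w (x %% n).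
have n0 : (0 < n)%N by apply: leq_ltn_trans kn.
have fn q x : f (x + q * n)%N = f x by rewrite /f addnC modnMDl.
have fk x : f (x + k)%N = ~~ f x.
  rewrite /f; have xn : (x %% n < n)%N by rewrite ltn_mod.
  rewrite -(nth_map false false negb xn) -E /rot nth_cat size_drop -/n.
  rewrite -modnDml; case: ltnP => h.
    by rewrite nth_drop addnC modn_small // -ltn_subRL.
  have -> : (x %% n + k = (x %% n - (n - k)) + n)%N by lia.
  by rewrite modnDr modn_small ?nth_take //; lia.
have fkm u x : f (x + u * k)%N = f x (+) odd u.
  elim: u => [|u IH]; first by rewrite addn0 addbF.
  by rewrite mulSnr addnA fk IH addbN.
(* Bezout gives u k = v n + g, so a shift by g flips the letters exactly when u is odd. *)
case: (egcdnP n k0) => u v uv _; set g := gcdn k n in uv.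
have fg x : f (x + g)%N = f x (+) odd u.
  by rewrite -(fn v) -addnA [(g + _)%N]addnC -uv fkm.
have fgm q x : f (x + q * g)%N = f x (+) (odd u && odd q).
  elim: q => [|q IH]; first by rewrite addn0 andbF addbF.
  by rewrite mulSnr addnA fg IH /=; case: (odd u); case: (odd q); case: (f x).
(* The shift by k, a multiple of g, flips letters, hence u is odd; the shift by n = q g does not,
   hence q is even. *)
have /dvdnP[k' k'E] : g %| k by apply: dvdn_gcdl.
have /dvdnP[q qE] : g %| n by apply: dvdn_gcdr.
have ou : odd u.
  by have := fgm k' 0%N; rewrite -k'E fk; case: (odd u); case: (f 0%N).
have eq : ~~ odd q.
  by have := fgm q 0%N; rewrite -qE -[n]mul1n fn ou;
    case: (odd q); case: (f 0%N).
have {}fg x : f (x + g)%N = ~~ f x by rewrite fg ou addbT.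
(* c consists of the first g letters, the next g letters are its reflection, and this block of
   length 2g repeats; q is even and nonzero, so the exponent is positive. *)
exists (mkseq f g), q./2; split; first by case: (q) qE eq => [|[]] //; lia.
have wE : w = mkseq f n.
  apply: (@eq_from_nth _ false); rewrite ?size_mkseq // => i iw.
  by rewrite nth_mkseq // /f modn_small.
have {}qE : n = (q./2 * (g + g))%N.
  by rewrite qE -{1}(even_halfK eq) -muln2 -mulnA mul2n addnn.
rewrite wE qE; have f2g x : f (g + g + x)%N = f x.
  by rewrite addnC addnA !fg negbK.
elim: (q./2) => [|l IH]; first by rewrite /braid_of big_nil.
rewrite mulSn expgS -IH /mkseq iotaD map_cat add0n braid_of_cat; congr (_ * _).
  rewrite iotaD map_cat braid_of_cat add0n; congr (_ * braid_of _).
  rewrite -[X in iota X _]addn0 iotaDl -map_comp /wreflection -map_comp.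
  by apply: eq_map => x /=; rewrite addnC fg.
congr braid_of; rewrite -[X in iota X _]addn0 iotaDl -map_comp.
by apply: eq_map => x /=; rewrite f2g.
Qed.

(** * What follows when the infimum is not 0 or the form condition fails *)

Lemma has_Delta_factor_cyclic a :
  has_Delta_factor a -> cyclic_equivalent a (reflection a).
Proof.
move=> [_ [_ [[u ->] [v ->] ->]]].
have E : braid_of u * Delta * braid_of v
         = Delta * braid_of (wreflection u ++ v).
  by rewrite braid_of_Delta braid_of_cat -[LHS]mulgA.
have := @cyclic_reflection_Delta [::] (u ++ [:: false; true; false] ++ v).
rewrite cats0 cat0s !braid_of_cat (braid_of_Delta_word false) mulgA; apply.
exact: E.
Qed.

(** Without a factor Delta, a is its own normal form with exponent 0, and the infimum is unique. *)
Lemma inf_neq0_factor a :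
  positive a -> braid_inf a <> 0%R -> has_Delta_factor a.
Proof.
move=> pa inf0; case: (pselect (has_Delta_factor a)) => // noD; case: inf0.
apply: (@is_inf_unique a); first exact: svalP.
by exists a; rewrite mul1g.
Qed.

(* The rotations of [w] see all factors of length 3 of [w ++ w] only when
   [w] has at least 3 letters; [sigma_i sigma_j] is the exception. *)
Lemma not_reduced_sqr_cyclic w : ~~ reduced (w ++ w) ->
  cyclic_equivalent (braid_of w) (reflection (braid_of w)).
Proof.
case/reducedPn=> p [i [q E]].
have [w2|w3] := leqP (size w) 2.
  suff [j ->] : exists j, w = [:: j; ~~ j].
    have := @cyclic_reflection_sqr [:: j] 1 isT.
    by rewrite /= expg1 -braid_of_cat.
  case: w w2 E => [|x [|y []]] // _; case: p => [|? [|? [|? [|? p]]]] //= [] //.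
  - by move=> -> -> _ _; exists i.
  - by move=> _ -> -> _; exists (~~ i); rewrite negbK.
  - by case: p.
(* Either [iji] lies inside the second copy of w, or it starts in the first copy. *)
have [pw|wp] := leqP (size w) (size p).
  have [p' pE] : exists p', p = w ++ p'.
    exists (drop (size w) p); rewrite -{1}(take_size_cat w (erefl (size w))) E.
    by rewrite takel_cat // cat_take_drop.
  have wE : w = p' ++ [:: i; ~~ i; i] ++ q.
    by move/eqP: E; rewrite pE -catA eqseq_cat // eqxx => /eqP.
  have [u uE] := braid_of_iji p' i q.
  have := @cyclic_reflection_Delta [::] w u; rewrite cats0 cat0s; apply.
  by rewrite wE.
have wE := cat_take_drop (size p) w.
have : drop (size p) (w ++ w) = drop (size p) w ++ w.
  by rewrite drop_cat wp.
rewrite E drop_size_cat // => D.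
(* The rotation of w by [size p] begins with [iji], as w has at least three letters. *)
have T : take 3 (drop (size p) w ++ take (size p) w) = [:: i; ~~ i; i].
  have : take 3 ((drop (size p) w ++ take (size p) w) ++ drop (size p) w)
      = [:: i; ~~ i; i].
    by rewrite -catA wE -D /= take0.
  by rewrite takel_cat // size_cat addnC -size_cat wE.
have [u uE] :=
  braid_of_iji [::] i (drop 3 (drop (size p) w ++ take (size p) w)).
have := @cyclic_reflection_Delta (take (size p) w) (drop (size p) w) u.
by rewrite wE; apply; rewrite -uE cat0s -T cat_take_drop.
Qed.

(** * Cyclic equivalence with the reflection, characterised by the three conditions *)

Theorem proposition3p6 (a : B3)
    (a_positive : positive a) (ra_positive : positive (reflection a))
    (a_conj : conjugate a (reflection a)) :
  cyclic_equivalent a (reflection a) <->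
  [\/ ~ (braid_inf a = 0%R),
      ~ ((exists (i : letter) (s : seq nat), first_form i s a) \/
         (exists (i : letter) (s : seq nat),
            [/\ second_form i s a, (2 <= head 0 s)%N & (2 <= last 0 s)%N])) |
      ~ (forall (c : seq letter) (l : nat), (1 <= l)%N ->
           a <> (braid_of c * braid_of (wreflection c)) ^+ l)].
Proof.
rewrite -/(form_condition a); split=> [cyc|].
  case: (pselect (form_condition a)) => [fa|nfa]; last by constructor 2.
  (* Under condition (2) the reflected word is a rotation of w, which writes a as a power of c cbar,
     against (3). *)
  constructor 3 => noc; have [w [aE rw]] := form_condition_word _ fa.
  move: cyc; rewrite aE => /(cyclic_rot _ _ rw) [k].
  rewrite reflection_braid_of => /esym E.
  have /esym := reduced_unique _ _ (reduced_rot k w rw) E.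
  move=> /antiperiod_word [c [l [l0 wE]]].
  by apply: (noc c l l0); rewrite aE.
case=> [inf0|nform|pow].
- exact/has_Delta_factor_cyclic/inf_neq0_factor.
- have [w aE] := a_positive; rewrite aE in nform *.
  by apply: not_reduced_sqr_cyclic; apply/negP => /word_form_condition.
- move/existsNP: pow => [c /existsNP[l /not_implyP[l0 /contrapT ->]]].
  exact: cyclic_reflection_sqr.
Qed.
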